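(* Assume all rewards $R_i^{(j)}(t)$ and $R_{mn}^{(jk)}(t)$ lie in $[0,1]$, and let $\mathcal{F}=[M]^N$. Let $$\gamma=\min\left\{1,\sqrt{\frac{M(N+|\mathcal{E}|M)\ln M^N}{(e-1)(N+|\mathcal{E}|)T}}\right\},\qquad \alpha=\frac{\gamma}{M(N+|\mathcal{E}|M)},$$ and let $\hat{R}_{total}$ be the total reward achieved by the algorithm MABSTA$(\gamma,\alpha)$ over the $T$ data frames. Then $$R_{total}^{max}-\mathbb{E}\{\hat{R}_{total}\}\le 2.63\sqrt{(N+|\mathcal{E}|)(N+|\mathcal{E}|M)\,M N T\ln M}.$$
   Context: Setting. $N\ge1$, $M\ge1$, $T\ge1$ are integers, $[K]=\{1,\dots,K\}$. $G=(\mathcal{V},\mathcal{E})$ is a directed acyclic graph with vertex set $\mathcal{V}=[N]$ (tasks); $|\mathcal{E}|$ is its number of edges. $[M]$ is the set of devices. An assignment (arm) is a vector $\mathbf{y}=(y_1,\dots,y_N)\in[M]^N$, where $y_i$ is the device executing task $i$; $\mathcal{F}\subseteq[M]^N$ is the set of feasible assignments. The rewards are arbitrary fixed (deterministic) sequences, unknown to the algorithm: for $t\in[T]$, $R_i^{(j)}(t)\in[0,1]$ for $i\in[N]$, $j\in[M]$ (executing task $i$ on device $j$), and $R_{mn}^{(jk)}(t)\in[0,1]$ for $(m,n)\in\mathcal{E}$, $j,k\in[M]$ (transmitting the data of edge $(m,n)$ from device $j$ to device $k$). The best fixed assignment in hindsight has total reward $$R_{total}^{max}=\max_{\mathbf{x}\in\mathcal{F}}\sum_{t=1}^T\Big(\sum_{i=1}^N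 R_i^{(x_i)}(t)+\sum_{(m,n)\in\mathcal{E}}R_{mn}^{(x_mx_n)}(t)\Big).$$ Algorithm MABSTA$(\gamma,\alpha)$. Set $w_{\mathbf{y}}(1)=1$ for all $\mathbf{y}\in\mathcal{F}$. For $t=1,\dots,T$: (1) let $W_t=\sum_{\mathbf{y}\in\mathcal{F}}w_{\mathbf{y}}(t)$ and $p_{\mathbf{y}}(t)=(1-\gamma)\frac{w_{\mathbf{y}}(t)}{W_t}+\frac{\gamma}{|\mathcal{F}|}$; (2) given the past, draw $\mathbf{x}^t\in\mathcal{F}$ from the distribution $(p_{\mathbf{y}}(t))_{\mathbf{y}\in\mathcal{F}}$ and observe the rewards $R_i^{(x_i^t)}(t)$, $i\in[N]$, and $R_{mn}^{(x_m^tx_n^t)}(t)$, $(m,n)\in\mathcal{E}$; (3) let $\mathcal{C}_{ex}^i=\{\mathbf{z}\in\mathcal{F}: z_i=x_i^t\}$ and $\mathcal{C}_{tx}^{mn}=\{\mathbf{z}\in\mathcal{F}: z_m=x_m^t,\ z_n=x_n^t\}$, and define $\hat{R}_i^{(j)}(t)=R_i^{(j)}(t)/\sum_{\mathbf{z}\in\mathcal{C}_{ex}^i}p_{\mathbf{z}}(t)$ if $x_i^t=j$ and $0$ otherwise, and $\hat{R}_{mn}^{(jk)}(t)=R_{mn}^{(jk)}(t)/\sum_{\mathbf{z}\in\mathcal{C}_{tx}^{mn}}p_{\mathbf{z}}(t)$ if $x_m^t=j$ and $x_n^t=k$, and $0$ otherwise; (4) for all $\mathbf{y}\in\mathcal{F}$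 set $\hat{R}_{\mathbf{y}}(t)=\sum_{i=1}^N\hat{R}_i^{(y_i)}(t)+\sum_{(m,n)\in\mathcal{E}}\hat{R}_{mn}^{(y_my_n)}(t)$ and $w_{\mathbf{y}}(t+1)=w_{\mathbf{y}}(t)\exp(\alpha\hat{R}_{\mathbf{y}}(t))$. The total reward achieved is $\hat{R}_{total}=\sum_{t=1}^T\big(\sum_{i=1}^N R_i^{(x_i^t)}(t)+\sum_{(m,n)\in\mathcal{E}}R_{mn}^{(x_m^tx_n^t)}(t)\big)$, and $\mathbb{E}$ is expectation over the algorithm's random draws $\mathbf{x}^1,\dots,\mathbf{x}^T$. *)

(* Defs.v *)
From mathcomp Require Export all_boot all_order all_algebra.
From mathcomp Require Export all_classical all_reals all_analysis.

Set Implicit Arguments.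
Unset Strict Implicit.
Unset Printing Implicit Defensive.
Import Order.TTheory GRing.Theory Num.Theory.
Local Open Scope ring_scope.

Definition acyclic (N : nat) (E : {set 'I_N * 'I_N}) : Prop :=
  forall c : seq 'I_N, cycle (fun m n => (m, n) \in E) c -> c = [::].

Section Mabsta.
Context (R : realType) (N M : nat).

(* The devices y_1, ..., y_N executing the tasks. *)
Definition assignment := {ffun 'I_N -> 'I_M}.

(* Frames are numbered from 0: the index t stands for the (t+1)-st frame.
   [Rex t i j] is the reward for executing task i on device j, and
   [Rtx t m n j k] the one for sending the data of edge (m, n) from device j
   to device k; the latter is only ever used when (m, n) is in E. *)
Context (E : {set 'I_N * 'I_N}) (F : {set assignment}).
Context (Rex : nat -> 'I_N -> 'I_M -> R).
Context (Rtx : nat -> 'I_N -> 'I_N -> 'I_M -> 'I_M -> R).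

Definition frame_reward (t : nat) (x : assignment) : R :=
  \sum_(i < N) Rex t i (x i) +
  \sum_(e in E) Rtx t e.1 e.2 (x e.1) (x e.2).

(* A maximum, as F is finite. *)
Definition best_fixed_reward (T : nat) : R :=
  sup [set r : R | exists2 x, x \in F & r = \sum_(t < T) frame_reward t x]%classic.

Context (gamma alpha : R).

(* The distribution used for the draw when the current weights are w. *)
Definition draw_prob (w : assignment -> R) (y : assignment) : R :=
  (1 - gamma) * (w y / \sum_(z in F) w z) + gamma / #|F|%:R.

(* In the three estimates, p is the distribution of the draw in frame t and x
   the assignment that was drawn. *)
Definition est_ex (t : nat) (p : assignment -> R) (x : assignment)
    (i : 'I_N) (j : 'I_M) : R :=
  if x i == j then Rex t i j / \sum_(z in F | z i == x i) p z else 0.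

Definition est_tx (t : nat) (p : assignment -> R) (x : assignment)
    (m n : 'I_N) (j k : 'I_M) : R :=
  if (x m == j) && (x n == k) then
    Rtx t m n j k / \sum_(z in F | (z m == x m) && (z n == x n)) p z
  else 0.

Definition est_reward (t : nat) (p : assignment -> R) (x y : assignment) : R :=
  \sum_(i < N) est_ex t p x i (y i) +
  \sum_(e in E) est_tx t p x e.1 e.2 (y e.1) (y e.2).

(* Weights after the draws h, listed with the most recent one first, so that
   the last draw of x :: h' was made in frame [size h']. *)
Fixpoint weight (h : seq assignment) : assignment -> R :=
  match h with
  | [::] => fun=> 1
  | x :: h' => let w := weight h' in
      fun y => w y * expR (alpha * est_reward (size h') (draw_prob w) x y)
  end.

(* Joint law of the draws of the first T frames, in chronological order: the
   product of the conditional probabilities of each draw given the past. *)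
Definition draws_prob (T : nat) (xs : T.-tuple assignment) : R :=
  \prod_(t < T) draw_prob (weight (rev (take t xs))) (tnth xs t).

Definition expectation (T : nat) (f : T.-tuple assignment -> R) : R :=
  \sum_(xs : T.-tuple assignment | all (mem F) xs) draws_prob xs * f xs.

Definition total_reward (T : nat) (xs : T.-tuple assignment) : R :=
  \sum_(t < T) frame_reward t (tnth xs t).

Definition expected_total_reward (T : nat) : R := expectation (@total_reward T).

End Mabsta.

(* Main.v *)
(* MABSTA is Exp3 with exploration rate gamma over the M^N assignments, with
   importance-weighted estimates of each summand (task or edge) of the reward.
   Under the draw distribution p, the estimate of a summand with J possible
   outcomes is unbiased, at most J / gamma, and has expected p-second moment at
   most J.  By Cauchy-Schwarz the estimate of the whole reward has expected
   second moment at most (N + |E|) K with K = M (N + |E| M), and alpha times it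
   is at most 1, so exp x <= 1 + x + (e - 2) x^2 on [0, 1] controls the expected
   growth of ln W_t.  Comparing ln W_T with ln w_y(T) bounds the regret by
   (e - 1) gamma (N + |E|) T + K ln(M^N) / gamma, and the choice of gamma turns
   this into 2 sqrt(e - 1) sqrt((N + |E|) T K ln(M^N)), with 2 sqrt(e - 1) < 2.63.
   When gamma = 1 the trivial bound (N + |E|) T suffices, and when M = 1, where
   gamma = 0, there is a single assignment. *)
Require Import Defs.
From mathcomp Require Import ring lra.

Set Implicit Arguments.
Unset Strict Implicit.
Unset Printing Implicit Defensive.
Import Order.TTheory GRing.Theory Num.Theory.
Local Open Scope ring_scope.

(** * Estimates for the exponential series *)

Lemma expR_series_le (R : realType) (x : R) (b : R) :
  (forall k, \sum_(i < k.+2) exp_coeff x i <= b) -> expR x <= b.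
Proof.
move=> le_b; rewrite /expR.
apply: (cvgr_to_le (is_cvg_series_exp_coeff x)).
exists 2%N => // k /= k2; case: k k2 => [|[|k]] // _.
by rewrite /series /= big_mkord; exact: le_b.
Qed.

Lemma expR_series_ge (R : realType) (x : R) k : 0 <= x ->
  \sum_(i < k) exp_coeff x i <= expR x.
Proof.
move=> x0; rewrite /expR.
apply: limr_ge; first exact: is_cvg_series_exp_coeff.
exists k => // j /= kj; rewrite /series /= -(big_mkord xpredT).
by rewrite (big_cat_nat _ kj) //= lerDl sumr_ge0// => i _; exact: exp_coeff_ge0.
Qed.

(** On [0, 1], [x ^+ i <= x ^+ 2] for [i >= 2], so the part of the series beyond its linear term is
    at most [x ^+ 2] times the same part at 1, which sums to [expR 1 - 2]. *)
Lemma expR_le_quadratic (R : realType) (x : R) : 0 <= x <= 1 ->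
  expR x <= 1 + x + (expR 1 - 2) * x ^+ 2.
Proof.
move=> /andP[x0 x1]; apply: expR_series_le => k.
have sumE y : \sum_(i < k.+2) exp_coeff y i =
    1 + y + \sum_(i < k) (i.+2`!%:R)^-1 * y ^+ i.+2 :> R.
  rewrite 2!big_ord_recl /= !exp_coeffE /= !fact0 invr1 !mul1r expr0 expr1 addrA.
  by congr (_ + _); apply: eq_bigr => i _; rewrite exp_coeffE.
have := expR_series_ge k.+2 (@ler01 R); rewrite !sumE => leS.
rewrite lerD2l (@le_trans _ _ ((\sum_(i < k) (i.+2`!%:R)^-1 * 1 ^+ i.+2) * x ^+ 2))//.
  rewrite mulr_suml ler_sum// => i _; rewrite expr1n mulr1.
  rewrite ler_wpM2l ?invr_ge0// -addn2 exprD.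
  by rewrite ler_piMl ?sqr_ge0// exprn_ile1.
by rewrite ler_wpM2r ?sqr_ge0//; lra.
Qed.

(* The partial sums of the exponential series at 1 satisfy
   [S_k + 2 / k! <= 65/24 + 2/120] for k >= 5, the left side being
   nonincreasing. *)
Lemma expR1_le (R : realType) : expR 1 <= 2729%:R / 1000%:R :> R.
Proof.
pose s k : R := \sum_(i < k) exp_coeff 1 i.
have sS k : s k.+1 = s k + (k`!%:R)^-1.
  by rewrite /s big_ord_recr/= exp_coeffE /= expr1n mulr1.
have factS k : (k.+1`!%:R)^-1 = (k.+1%:R)^-1 * (k`!%:R)^-1 :> R.
  by rewrite factS natrM invfM.
(* Passing from [k] to [k + 1] adds [1 / k!] to the sum, and [2 / (k + 1)! <= 1 / k!] since
   [k + 1 >= 2]. *)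
have dec k : (0 < k)%N -> s k.+1 + 2 * (k.+1`!%:R)^-1 <= s k + 2 * (k`!%:R)^-1.
  move=> k0; rewrite sS factS.
  have : (k.+1%:R)^-1 <= 2^-1 :> R by rewrite lef_pV2 ?posrE// ler_nat.
  have : 0 <= (k`!%:R)^-1 :> R by rewrite invr_ge0.
  by move: (k.+1%:R)^-1 (k`!%:R)^-1 => u v; nra.
have bnd k : s (k + 5)%N + 2 * ((k + 5)`!%:R)^-1 <= 2729%:R / 1000%:R.
  elim: k => [|k IH]; last by rewrite addSn; apply: le_trans IH; apply: dec; rewrite addnS.
  rewrite add0n !sS /s big_ord0 !factS fact0; lra.
apply: expR_series_le => k.
have : s k.+2 <= s (k + 5)%N.
  have k5 : (k.+2 <= k + 5)%N by rewrite -addn2 leq_add2l.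
  rewrite /s -!(big_mkord xpredT (exp_coeff 1)) (big_cat_nat _ k5)//=.
  by rewrite lerDl sumr_ge0// => i _; apply: exp_coeff_ge0.
move=> /le_trans; apply; apply: le_trans (bnd k).
by rewrite lerDl mulr_ge0// invr_ge0.
Qed.

(** Cauchy-Schwarz: expand the square and sum [2 f i f j <= f i ^+ 2 + f j ^+ 2] over all pairs. *)
Lemma sqr_sum_le (R : realType) (I : finType) (P : pred I) (f : I -> R) :
  (\sum_(i | P i) f i) ^+ 2 <= #|P|%:R * \sum_(i | P i) f i ^+ 2.
Proof.
have -> : #|P|%:R * \sum_(i | P i) f i ^+ 2 =
    \sum_(i | P i) \sum_(j | P j) (f i ^+ 2 + f j ^+ 2) / 2.
  under [RHS]eq_bigr do rewrite -mulr_suml big_split/= sumr_const.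
  rewrite -mulr_suml big_split/= sumr_const sumrMnl -mulr_natl.
  by field.
rewrite expr2 mulr_suml ler_sum// => i _; rewrite mulr_sumr ler_sum// => j _.
by have := sqr_ge0 (f i - f j); nra.
Qed.

(** * Importance-weighted estimates *)

Section ImportanceWeighting.
Context (R : realType) (X J : finType).

(** [x] is the draw and [y] the point whose reward is estimated. The map [pi] is what a summand sees
    of an assignment: one device for a task, two for an edge. *)
Definition importance_estimate (p : X -> R) (pi : X -> J) (r : X -> R) (x y : X) : R :=
  if pi x == pi y then r y / \sum_(z | pi z == pi x) p z else 0.

Context (p : X -> R) (pi : X -> J) (r : X -> R).
Hypothesis p_gt0 : forall x, 0 < p x.

Let class_prob_gt0 x : 0 < \sum_(z | pi z == pi x) p z.
Proof.
rewrite (bigD1 x)//= ltr_pwDl// sumr_ge0// => z _; exact: ltW.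
Qed.

(** Only draws in the class of [y] contribute, and their total mass cancels the denominator. *)
Lemma importance_estimate_unbiased y :
  \sum_x p x * importance_estimate p pi r x y = r y.
Proof.
rewrite (eq_bigr (fun x => if pi x == pi y then p x * (r y / \sum_(z | pi z == pi y) p z) else 0)).
  rewrite -big_mkcond -mulr_suml mulrCA mulfV ?mulr1//.
  by rewrite gt_eqF.
by move=> x _; rewrite /importance_estimate; case: eqP => [->|_]//; rewrite mulr0.
Qed.

(** Here the average runs over the estimated point, with the draw fixed. It turns the linear term in
    the growth of the weights into the reward actually collected. *)
Lemma importance_estimate_mean x : (forall y, pi x = pi y -> r x = r y) ->
  \sum_y p y * importance_estimate p pi r x y = r x.
Proof.
move=> rpi.
rewrite (eq_bigr (fun y => if pi y == pi x then p y * (r x / \sum_(z | pi z == pi x) p z) else 0)).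
  rewrite -big_mkcond -mulr_suml mulrCA mulfV ?mulr1//.
  by rewrite gt_eqF.
move=> y _; rewrite /importance_estimate eq_sym.
by case: eqP => [e|_]; [rewrite (rpi y)|rewrite mulr0].
Qed.

Hypothesis r01 : forall x, 0 <= r x <= 1.

Lemma importance_estimate_ge0 x y : 0 <= importance_estimate p pi r x y.
Proof.
rewrite /importance_estimate; case: ifP => // _.
by rewrite divr_ge0 ?(ltW (class_prob_gt0 _))//; case/andP: (r01 y).
Qed.

Lemma importance_estimate_le (c : R) x y : 0 < c ->
  c <= \sum_(z | pi z == pi x) p z -> importance_estimate p pi r x y <= c^-1.
Proof.
move=> c0 cP; rewrite /importance_estimate; case: ifP => _; last by rewrite invr_ge0 ltW.
rewrite -[leRHS]mul1r ler_pM ?invr_ge0 ?(ltW (class_prob_gt0 _))//; try by case/andP: (r01 y).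
by rewrite lef_pV2// posrE.
Qed.

(** Rewards being at most 1, the inner sum is at most [1 / q x], where [q x] is the mass of the
    class of [x]; summed over one class, [p x / q x] gives at most 1. *)
Lemma importance_estimate_second_moment :
  \sum_x p x * (\sum_y p y * importance_estimate p pi r x y ^+ 2) <= #|J|%:R.
Proof.
apply: (@le_trans _ _ (\sum_x p x / \sum_(z | pi z == pi x) p z)).
  apply: ler_sum => x _; rewrite ler_pM2l//.
  set q := \sum_(z | pi z == pi x) p z.
  have q0 : 0 < q by exact: class_prob_gt0.
  apply: (@le_trans _ _ (\sum_(y | pi y == pi x) p y * (q^-1 ^+ 2))).
    rewrite [leRHS]big_mkcond; apply: ler_sum => y _.
    rewrite /importance_estimate eq_sym -/q; case: ifP => _; last by rewrite expr0n/= mulr0.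
    rewrite ler_pM2l// exprMn ler_piMl ?sqr_ge0//.
    by case/andP: (r01 y) => ? ?; rewrite exprn_ile1.
  by rewrite -mulr_suml -/q expr2 mulrA mulfV ?gt_eqF// mul1r.
rewrite (partition_big pi predT)//= -sum1_card natr_sum.
apply: ler_sum => j _.
rewrite (eq_bigr (fun x => p x / \sum_(z | pi z == j) p z)); last by move=> x /eqP ->.
rewrite -mulr_suml; set q := \sum_(z | _) _.
by have [->|q0] := eqVneq q 0; rewrite ?mul0r// mulfV.
Qed.

End ImportanceWeighting.

(** * One step of exponential weights *)

(** The ratio of the two sums is the average of [expR (alpha * s y)] under the normalized weights.
    Apply the quadratic estimate, then [ln (1 + z) <= z], and pass from the normalized weights to
    [p] at the cost of the factor [1 - gamma]. *)
Lemma exp_weights_step (R : realType) (X : finType) (w p s : X -> R)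
    (gamma alpha : R) (x0 : X) :
  (forall y, 0 < w y) -> 0 <= gamma <= 1 ->
  (forall y, (1 - gamma) * (w y / \sum_z w z) <= p y) ->
  (forall y, 0 <= alpha * s y <= 1) ->
  (1 - gamma) * (ln (\sum_y w y * expR (alpha * s y)) - ln (\sum_y w y)) <=
  alpha * \sum_y p y * s y + (expR 1 - 2) * alpha ^+ 2 * \sum_y p y * s y ^+ 2.
Proof.
move=> w0 /andP[g0 g1] pw as01.
have W0 : 0 < \sum_y w y.
  by rewrite (bigD1 x0)//= ltr_pwDl// sumr_ge0// => z _; exact: ltW.
have W'0 : 0 < \sum_y w y * expR (alpha * s y).
  rewrite (bigD1 x0)//= ltr_pwDl ?mulr_gt0 ?expR_gt0// sumr_ge0// => z _.
  by rewrite mulr_ge0 ?expR_ge0// ltW.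
have e2 : 2 <= expR 1 :> R.
  by apply: le_trans (expR_ge1Dx 1); lra.
pose u y := alpha * s y + (expR 1 - 2) * (alpha * s y) ^+ 2.
have u0 y : 0 <= u y.
  have /andP[a0 _] := as01 y; rewrite addr_ge0// mulr_ge0 ?sqr_ge0//; lra.
rewrite -ln_div ?posrE//.
have ratio : (\sum_y w y * expR (alpha * s y)) / (\sum_y w y) <=
    1 + \sum_y w y / (\sum_z w z) * u y.
  rewrite ler_pdivrMr// mulrDl mul1r mulr_suml -big_split/=; apply: ler_sum => y _.
  rewrite (mulrAC (w y / _)) divfK ?gt_eqF//.
  rewrite -{2}[w y]mulr1 -mulrDr ler_pM2l// /u addrA.
  exact: expR_le_quadratic.
apply: (@le_trans _ _ ((1 - gamma) * \sum_y w y / (\sum_z w z) * u y)).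
  rewrite ler_wpM2l ?subr_ge0//.
  have pos : 0 <= \sum_y w y / (\sum_z w z) * u y.
    by apply: sumr_ge0 => y _; rewrite mulr_ge0// divr_ge0 ?ltW.
  apply: (@le_trans _ _ (ln (1 + \sum_y w y / (\sum_z w z) * u y))).
    by rewrite ler_ln ?posrE ?divr_gt0// ltr_pwDl.
  by apply: le_ln1Dx; apply: lt_le_trans pos; rewrite ltrN10.
rewrite !mulr_sumr -big_split/=; apply: ler_sum => y _.
rewrite [leRHS](_ : _ = p y * u y); last by rewrite /u; ring.
by rewrite mulrA ler_wpM2r.
Qed.

(** Coordinates in [S] are pinned to one device, the others are free. The product form avoids
    subtraction in the exponent. *)
Lemma card_agreeing_assignments (N M : nat) (S : {set 'I_N}) (x : assignment N M) :
  (#|[pred z : assignment N M | [forall i in S, z i == x i]]| * M ^ #|S| = M ^ N)%N.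
Proof.
pose B i : pred 'I_M := if i \in S then pred1 (x i) else predT.
have -> : #|[pred z : assignment N M | [forall i in S, z i == x i]]| =
    (\prod_(i < N) #|B i|)%N.
  have -> : (\prod_(i < N) #|B i|)%N = #|family (fun i => B i)|.
    by rewrite card_family foldrE big_map big_enum.
  apply: eq_card => z; rewrite !inE; apply/forall_inP/familyP => zx i.
    by rewrite /B; case: ifP => // iS; rewrite inE zx.
  by move=> iS; have := zx i; rewrite /B iS inE.
have -> : (M ^ #|S| = \prod_(i < N) (if i \in S then M else 1))%N.
  by rewrite -big_mkcond prod_nat_const.
have -> : (M ^ N = \prod_(i < N) M)%N by rewrite prod_nat_const card_ord.
rewrite -big_split/=; apply: eq_bigr => i _; rewrite /B.
by case: ifP => _; rewrite ?card1 ?mul1n ?muln1 ?card_ord.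
Qed.

(** * The law of the draws *)

Section Mabsta.
Context (R : realType) (N M : nat).
Let X := assignment N M.
Let F := [set: X].
Context (E : {set 'I_N * 'I_N}).
Context (Rex : nat -> 'I_N -> 'I_M -> R).
Context (Rtx : nat -> 'I_N -> 'I_N -> 'I_M -> 'I_M -> R).
Context (gamma alpha : R).

Local Notation weight := (weight E F Rex Rtx gamma alpha).
Local Notation draw_prob := (draw_prob F gamma).
Local Notation draws_prob := (draws_prob E F Rex Rtx gamma alpha).
Local Notation expectation := (expectation E F Rex Rtx gamma alpha).
Local Notation est_reward := (est_reward E F Rex Rtx).
Local Notation frame_reward := (frame_reward E Rex Rtx).
Local Notation total_reward := (total_reward E Rex Rtx).

Lemma weight_gt0 h y : 0 < weight h y.
Proof. by elim: h => //= x h IH; rewrite mulr_gt0 ?expR_gt0. Qed.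

Lemma sum_weight_gt0 h (x0 : X) : 0 < \sum_y weight h y.
Proof.
rewrite (bigD1 x0)//= ltr_pwDl ?weight_gt0// sumr_ge0// => z _.
exact/ltW/weight_gt0.
Qed.

Lemma draw_probE w y : draw_prob w y =
  (1 - gamma) * (w y / \sum_z w z) + gamma / #|X|%:R.
Proof.
rewrite /draw_prob cardsT; congr (_ * (_ / _) + _).
by apply: eq_bigl => z; rewrite inE.
Qed.

Lemma draw_prob_sum1 (x0 : X) h : \sum_y draw_prob (weight h) y = 1.
Proof.
under eq_bigr do rewrite draw_probE.
rewrite big_split/= sumr_const -mulr_sumr -mulr_suml divff ?gt_eqF ?(sum_weight_gt0 _ x0)//.
rewrite -[Z in _ + Z]mulr_natr divfK ?pnatr_eq0; first by rewrite mulr1 subrK.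
by rewrite -lt0n; apply/card_gt0P; exists x0.
Qed.

Lemma draw_prob_ge h y : 0 <= gamma <= 1 ->
  gamma / #|X|%:R <= draw_prob (weight h) y.
Proof.
move=> /andP[g0 g1]; rewrite draw_probE lerDr mulr_ge0 ?subr_ge0// divr_ge0//.
  exact/ltW/weight_gt0.
exact/ltW/(sum_weight_gt0 _ y).
Qed.

Lemma draw_prob_ge0 h y : 0 <= gamma <= 1 -> 0 <= draw_prob (weight h) y.
Proof.
move=> g01; apply: le_trans (draw_prob_ge _ _ g01).
by rewrite divr_ge0//; case/andP: g01.
Qed.

Lemma draws_prob_ge0 T (xs : T.-tuple X) : 0 <= gamma <= 1 -> 0 <= draws_prob xs.
Proof. by move=> g01; apply: prodr_ge0 => t _; exact: draw_prob_ge0. Qed.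

Lemma expectationE T (f : T.-tuple X -> R) :
  expectation f = \sum_xs draws_prob xs * f xs.
Proof.
by apply: eq_bigl => xs; apply/allP => x _; rewrite /= inE.
Qed.

Lemma big_tuple_rcons T (f : T.+1.-tuple X -> R) :
  \sum_xs f xs = \sum_(xs : T.-tuple X) \sum_x f (rcons_tuple xs x).
Proof.
rewrite pair_big/= (reindex (fun q : T.-tuple X * X => rcons_tuple q.1 q.2))//=.
apply: onW_bij; apply: inj_card_bij.
  move=> [xs x] [ys y] /(congr1 val)/= /rcons_inj[/val_inj -> ->]//.
by rewrite card_prod !card_tuple expnSr.
Qed.

(** Tuples of draws are chronological while [weight] takes the most recent draw first, hence
    [rev]. *)
Lemma draws_prob_rcons T (xs : T.-tuple X) x :
  draws_prob (rcons_tuple xs x) = draws_prob xs * draw_prob (weight (rev xs)) x.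
Proof.
rewrite /draws_prob big_ord_recr/=; congr (_ * _).
  apply: eq_bigr => t _; rewrite !(tnth_nth x)/= nth_rcons size_tuple ltn_ord.
  by rewrite -cats1 takel_cat// size_tuple ltnW.
rewrite (tnth_nth x)/= nth_rcons size_tuple ltnn eqxx.
by rewrite -cats1 take_size_cat ?size_tuple.
Qed.

Lemma total_reward_rcons T (xs : T.-tuple X) x :
  total_reward (rcons_tuple xs x) = total_reward xs + frame_reward T x.
Proof.
rewrite /total_reward big_ord_recr/=; congr (_ + _).
  by apply: eq_bigr => t _; rewrite !(tnth_nth x)/= nth_rcons size_tuple ltn_ord.
by rewrite (tnth_nth x)/= nth_rcons size_tuple ltnn eqxx.
Qed.

(** Tower rule: condition on the first [T] draws and average over the last. *)
Lemma expectation_rcons T (f : T.+1.-tuple X -> R) :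
  expectation f =
  expectation (fun xs : T.-tuple X =>
    \sum_x draw_prob (weight (rev xs)) x * f (rcons_tuple xs x)).
Proof.
rewrite !expectationE big_tuple_rcons; apply: eq_bigr => xs _.
by rewrite mulr_sumr; apply: eq_bigr => x _; rewrite draws_prob_rcons mulrA.
Qed.

Lemma expectation0 (f : 0.-tuple X -> R) : expectation f = f [tuple].
Proof.
rewrite expectationE (big_pred1 [tuple]) => [|xs]; last exact/esym/eqP/tuple0.
by rewrite /draws_prob big_ord0 mul1r.
Qed.

Lemma expectation_cst (x0 : X) T (c : R) :
  expectation (fun _ : T.-tuple X => c) = c.
Proof.
elim: T => [|T IH]; first by rewrite expectation0.
rewrite expectation_rcons -[RHS]IH !expectationE; apply: eq_bigr => xs _.
by rewrite -mulr_suml draw_prob_sum1// mul1r.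
Qed.

Lemma le_expectation T (f g : T.-tuple X -> R) : 0 <= gamma <= 1 ->
  (forall xs, f xs <= g xs) -> expectation f <= expectation g.
Proof.
move=> g01 fg; rewrite !expectationE; apply: ler_sum => xs _.
by rewrite ler_wpM2l// draws_prob_ge0.
Qed.

Lemma expectationZ T (c : R) (f : T.-tuple X -> R) :
  expectation (fun xs => c * f xs) = c * expectation f.
Proof.
rewrite !expectationE mulr_sumr; apply: eq_bigr => xs _; ring.
Qed.

Lemma expectationDcst (x0 : X) T (f : T.-tuple X -> R) (c : R) :
  expectation (fun xs => f xs + c) = expectation f + c.
Proof.
rewrite -{2}(expectation_cst x0 T c) !expectationE -big_split/=.
by apply: eq_bigr => xs _; rewrite mulrDr.
Qed.

(** Supermartingale argument: [c t] bounds the conditional expected increase of the potential [G] in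
    frame [t], and the increases telescope. *)
Lemma expectation_drift (x0 : X) (G : forall t, t.-tuple X -> R) (c : nat -> R) T :
  0 <= gamma <= 1 ->
  (forall t (xs : t.-tuple X), (t < T)%N ->
    \sum_x draw_prob (weight (rev xs)) x * G t.+1 (rcons_tuple xs x)
      <= G t xs + c t) ->
  expectation (G T) <= G 0 [tuple] + \sum_(t < T) c t.
Proof.
move=> g01; elim: T => [|T IH] drift; first by rewrite expectation0 big_ord0 addr0.
rewrite expectation_rcons big_ord_recr/= addrA.
apply: (@le_trans _ _ (expectation (fun xs : T.-tuple X => G T xs + c T))).
  by apply: le_expectation => // xs; exact: drift.
rewrite expectationDcst// lerD2r; apply: IH => t xs tT.
by apply: drift; exact: ltnW.
Qed.

(* The tasks and the edges, treated uniformly as the summands of the reward. *)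
Let component : finType := ('I_N + 'I_N * 'I_N)%type.

Let used (a : component) : bool := if a is inr e then e \in E else true.

Let outcome (a : component) : finType :=
  match a with inl _ => 'I_M | inr _ => ('I_M * 'I_M)%type end.

Let choice_at (a : component) : X -> outcome a :=
  match a with inl i => fun x => x i | inr e => fun x => (x e.1, x e.2) end.

Let component_reward t (a : component) (x : X) : R :=
  match a with inl i => Rex t i (x i) | inr e => Rtx t e.1 e.2 (x e.1) (x e.2) end.

Let frame_reward_components t x :
  frame_reward t x = \sum_(a | used a) component_reward t a x.
Proof. by rewrite big_sumType. Qed.

Let est_reward_components t p x y :
  est_reward t p x y = \sum_(a | used a)
    importance_estimate p (@choice_at a) (component_reward t a) x y.
Proof.
rewrite big_sumType /est_reward; congr (_ + _); apply: eq_bigr => i _.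
  rewrite /est_ex /importance_estimate/=; case: ifP => // _.
  by congr (_ / _); apply: eq_bigl => z; rewrite inE.
rewrite /est_tx /importance_estimate/= xpair_eqE; case: ifP => // _.
by congr (_ / _); apply: eq_bigl => z; rewrite inE xpair_eqE.
Qed.

Let card_used : #|used| = (N + #|E|)%N.
Proof.
by rewrite -[LHS]sum1_card big_sumType/= !sum1_card card_ord.
Qed.

Let sum_card_outcome :
  (\sum_(a | used a) #|outcome a| = M * (N + #|E| * M))%N.
Proof.
rewrite big_sumType/= card_prod !sum_nat_const !card_ord; ring.
Qed.

Let component_reward_choice t a x y : @choice_at a x = @choice_at a y ->
  component_reward t a x = component_reward t a y.
Proof. by case: a => [i|e] /=; [move=> -> | case=> -> ->]. Qed.

(** Exploration gives each assignment mass at least [gamma / M ^ N], and fixing the coordinates in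
    [S] leaves [M ^ N / M ^ #|S|] assignments. *)
Let choice_prob_ge h a x : 0 <= gamma <= 1 -> (0 < M)%N ->
  gamma / #|outcome a|%:R <=
  \sum_(z | @choice_at a z == @choice_at a x) draw_prob (weight h) z.
Proof.
move=> g01 M0; have /andP[g0 _] := g01.
pose S := match a with inl i => [set i] | inr e => [set e.1; e.2] end : {set 'I_N}.
pose A : pred X := [pred z : X | [forall i in S, z i == x i]].
have AE z : (@choice_at a z == @choice_at a x) = A z.
  rewrite /A /S; case: (a) => [i|e]; rewrite /= ?xpair_eqE; apply/idP/forall_inP.
  - by move=> zx j; rewrite inE => /eqP ->.
  - by apply; rewrite inE.
  - by move=> /andP[zx1 zx2] j; rewrite !inE => /orP[] /eqP ->.
  - by move=> zx; rewrite !zx// !inE eqxx ?orbT.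
(* Not always an equality: a pair with equal endpoints gives a singleton [S] but [M * M]
   outcomes. *)
have MS : (M ^ #|S| <= #|outcome a|)%N.
  rewrite /S; case: (a) => [i|e]; first by rewrite cards1 card_ord.
  rewrite card_prod card_ord mulnn leq_pexp2l// cards2; by case: (_ != _).
rewrite (eq_bigl _ _ AE).
apply: (@le_trans _ _ (\sum_(z | A z) gamma / #|X|%:R)); last first.
  by apply: ler_sum => z _; exact: draw_prob_ge.
rewrite sumr_const -[leRHS]mulr_natr -mulrA ler_wpM2l//.
have o0 : (0 < #|outcome a|)%N by apply: leq_trans MS; rewrite expn_gt0 M0.
have X0 : (0 < #|X|)%N by rewrite card_ffun !card_ord expn_gt0 M0.
rewrite ler_pdivlMl ?ltr0n// ler_pdivrMr ?ltr0n// -natrM ler_nat.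
by rewrite card_ffun !card_ord -(card_agreeing_assignments S x) leq_mul.
Qed.

Lemma draw_prob_gt0 h y : 0 < gamma <= 1 -> 0 < draw_prob (weight h) y.
Proof.
move=> /andP[g0 g1]; apply: lt_le_trans (draw_prob_ge h y _); last by rewrite ltW.
by rewrite divr_gt0// ltr0n; apply/card_gt0P; exists y.
Qed.

(** * Analysis of a single frame *)

Section Frame.
Variables (t : nat).
Hypothesis gamma01 : 0 < gamma <= 1.
Hypothesis Rex01 : forall i j, 0 <= Rex t i j <= 1.
Hypothesis Rtx01 : forall (m n : 'I_N) j k, (m, n) \in E -> 0 <= Rtx t m n j k <= 1.
Hypothesis M_gt0 : (0 < M)%N.

Let component_reward01 a x : used a -> 0 <= component_reward t a x <= 1.
Proof. by case: a => [i|[m n]] ua; [exact: Rex01|exact: Rtx01]. Qed.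

Lemma frame_reward_bounds x : 0 <= frame_reward t x <= (N + #|E|)%:R.
Proof.
rewrite frame_reward_components sumr_ge0 => [/=|a /component_reward01 ua]; last first.
  by case/andP: (ua x).
rewrite -card_used -sum1_card natr_sum; apply: ler_sum => a.
by move=> /component_reward01 ua; case/andP: (ua x).
Qed.

Lemma est_reward_unbiased h y :
  \sum_x draw_prob (weight h) x * est_reward t (draw_prob (weight h)) x y =
  frame_reward t y.
Proof.
under eq_bigr do rewrite est_reward_components mulr_sumr.
rewrite exchange_big frame_reward_components; apply: eq_bigr => a ua.
by rewrite importance_estimate_unbiased// => x; exact: draw_prob_gt0.
Qed.

Lemma est_reward_mean h x :
  \sum_y draw_prob (weight h) y * est_reward t (draw_prob (weight h)) x y =
  frame_reward t x.
Proof.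
under eq_bigr do rewrite est_reward_components mulr_sumr.
rewrite exchange_big frame_reward_components; apply: eq_bigr => a ua.
rewrite importance_estimate_mean// => [y|y]; first exact: draw_prob_gt0.
exact: component_reward_choice.
Qed.

(** Cauchy-Schwarz over the [N + #|E|] summands gives the first factor; their second moments add up
    to at most the total number of outcomes. *)
Lemma est_reward_second_moment h :
  \sum_x draw_prob (weight h) x *
    (\sum_y draw_prob (weight h) y * est_reward t (draw_prob (weight h)) x y ^+ 2) <=
  (N + #|E|)%:R * (M * (N + #|E| * M))%:R.
Proof.
set p := draw_prob (weight h).
have p0 x : 0 < p x by exact: draw_prob_gt0.
pose s a x y := importance_estimate p (@choice_at a) (component_reward t a) x y.
apply: (@le_trans _ _ ((N + #|E|)%:R *
  \sum_(a | used a) \sum_x p x * \sum_y p y * s a x y ^+ 2)); last first.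
  rewrite ler_wpM2l// -sum_card_outcome natr_sum; apply: ler_sum => a ua.
  by apply: importance_estimate_second_moment => // x; exact: component_reward01.
rewrite exchange_big/= [leRHS]mulr_sumr; apply: ler_sum => x _.
rewrite -mulr_sumr mulrCA ler_pM2l// exchange_big/= [leRHS]mulr_sumr; apply: ler_sum => y _.
rewrite -mulr_sumr [leRHS]mulrCA ler_pM2l// est_reward_components -card_used.
exact: sqr_sum_le.
Qed.

Lemma est_reward_bounds h x y :
  0 <= est_reward t (draw_prob (weight h)) x y <= (M * (N + #|E| * M))%:R / gamma.
Proof.
have /andP[g0 g1] := gamma01.
have p0 z : 0 < draw_prob (weight h) z by exact: draw_prob_gt0.
rewrite est_reward_components -sum_card_outcome natr_sum mulr_suml.
rewrite sumr_ge0 => [/=|a ua]; last first.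
  by apply: importance_estimate_ge0 => // z; exact: component_reward01.
apply: ler_sum => a ua; rewrite -[leRHS]invf_div.
have o0 : (0 < #|outcome a|)%N.
  by apply/card_gt0P; exists (@choice_at a x).
apply: importance_estimate_le => //.
- by move=> z; exact: component_reward01.
- by rewrite divr_gt0// ltr0n.
- by apply: choice_prob_ge => //; rewrite ltW.
Qed.

Hypothesis alphaE : alpha = gamma / (M * (N + #|E| * M))%:R.

(** For each draw [x], [exp_weights_step] applies to the estimates, since [alpha] keeps them scaled
    into [0, 1]. Averaging over [x] brings in the second moment. *)
Lemma ln_sum_weight_drift h : size h = t ->
  \sum_x draw_prob (weight h) x *
    ((1 - gamma) * (ln (\sum_y weight (x :: h) y) - ln (\sum_y weight h y))) <=
  alpha * \sum_x draw_prob (weight h) x * frame_reward t x +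
  (expR 1 - 2) * alpha ^+ 2 * ((N + #|E|)%:R * (M * (N + #|E| * M))%:R).
Proof.
move=> ht; set p := draw_prob (weight h).
have /andP[g0 g1] := gamma01.
have p0 x : 0 < p x by exact: draw_prob_gt0.
have e2 : 0 <= expR 1 - 2 :> R by have := expR_ge1Dx (1 : R); lra.
pose V x := \sum_y p y * est_reward t p x y ^+ 2.
apply: (@le_trans _ _ (\sum_x p x * (alpha * frame_reward t x +
    (expR 1 - 2) * alpha ^+ 2 * V x))).
  apply: ler_sum => x _; rewrite ler_pM2l//= ht -/p.
  rewrite -(est_reward_mean h x) -/p; apply: exp_weights_step => //.
  - by move=> y; exact: weight_gt0.
  - by rewrite ltW.
  - by move=> y; rewrite /p draw_probE lerDl divr_ge0// ltW.
  - move=> y; have /andP[s0 s1] := est_reward_bounds h x y.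
    rewrite -/p in s0 s1.
    have a0 : 0 <= alpha by rewrite alphaE divr_ge0// ltW.
    rewrite mulr_ge0//= (le_trans (ler_wpM2l a0 s1))// alphaE.
    (* For [N = 0] the constant [K] vanishes, and the product is 0. *)
    set K := _%:R; have [->|K0] := eqVneq K 0; first by rewrite mul0r mulr0 ler01.
    by rewrite mulf_div (mulrC K) divff// mulf_neq0// gt_eqF.
rewrite [leLHS](_ : _ = alpha * (\sum_x p x * frame_reward t x) +
    (expR 1 - 2) * alpha ^+ 2 * \sum_x p x * V x); last first.
  by rewrite !mulr_sumr -big_split/=; apply: eq_bigr => x _; ring.
rewrite lerD2l (ler_wpM2l (mulr_ge0 e2 (sqr_ge0 alpha)))//.
exact: est_reward_second_moment.
Qed.

End Frame.

(** * Regret against a fixed assignment *)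

Lemma regret_bound (T : nat) (y : X) :
  (0 < M)%N -> 0 < gamma <= 1 -> alpha = gamma / (M * (N + #|E| * M))%:R ->
  (forall t i j, (t < T)%N -> 0 <= Rex t i j <= 1) ->
  (forall t (m n : 'I_N) j k, (t < T)%N -> (m, n) \in E ->
     0 <= Rtx t m n j k <= 1) ->
  (1 - gamma) * alpha * (\sum_(t < T) frame_reward t y) -
    alpha * expectation (@Defs.total_reward R N M E Rex Rtx T) <=
  (1 - gamma) * ln (#|X|%:R) + T%:R * ((expR 1 - 2) * alpha ^+ 2 *
    ((N + #|E|)%:R * (M * (N + #|E| * M))%:R)).
Proof.
move=> M0 g01 aE R1 R2; have /andP[g0 g1] := g01.
have gge01 : 0 <= gamma <= 1 by rewrite ltW.
(* The potential [G] is this comparison of [y] with the total weight, minus [alpha] times the reward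
   collected so far. *)
pose Phi h := (1 - gamma) * (ln (\sum_z weight h z) - ln (weight h y)).
pose G t (xs : t.-tuple X) := Phi (rev xs) - alpha * total_reward xs.
set v := (expR 1 - 2) * alpha ^+ 2 * _.
(* One weight is at most the total, so the final potential is at least [- alpha] times the total
   reward. *)
have Phi_ge0 h : 0 <= Phi h.
  rewrite mulr_ge0 ?subr_ge0// ler_ln ?posrE ?weight_gt0//; last first.
    exact: (sum_weight_gt0 _ y).
  by rewrite (bigD1 y)//= lerDl sumr_ge0// => z _; exact/ltW/weight_gt0.
have drift t (xs : t.-tuple X) : (t < T)%N ->
    \sum_x draw_prob (weight (rev xs)) x * G t.+1 (rcons_tuple xs x) <=
    G t xs + (v - (1 - gamma) * alpha * frame_reward t y).
  move=> tT; set h := rev xs; set p := draw_prob (weight h).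
  have ht : size h = t by rewrite size_rev size_tuple.
  have := @ln_sum_weight_drift t g01 (fun i j => R1 t i j tT)
    (fun m n j k => R2 t m n j k tT) M0 aE h ht.
  rewrite -/p -/v => dW.
  (* [ln (weight h y)] grows by [alpha] times the estimate at [y], whose mean over the draw is the
     true reward of [y]. *)
  have unb := @est_reward_unbiased t g01 h y; rewrite -/p in unb.
  have p1 : \sum_x p x = 1 by exact: draw_prob_sum1 y h.
  rewrite [leLHS](_ : _ = \sum_x p x *
      ((1 - gamma) * (ln (\sum_y weight (x :: h) y) - ln (\sum_y weight h y))) -
      (1 - gamma) * alpha * (\sum_x p x * est_reward t p x y) -
      alpha * (\sum_x p x * frame_reward t x) + (\sum_x p x) * G t xs).
    by rewrite unb p1 mul1r; lra.
  rewrite !mulr_sumr mulr_suml -!sumrB -big_split/=; apply: eq_bigr => x _.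
  rewrite /G /Phi total_reward_rcons [tval _]/= rev_rcons -/h /= ht -/p.
  by rewrite lnM ?posrE ?weight_gt0 ?expR_gt0// expRK; ring.
have := expectation_drift y gge01 drift.
rewrite sumrB sumr_const card_ord -mulr_sumr -[v *+ T]mulr_natl.
have G0 : G 0%N [tuple] = (1 - gamma) * ln (#|X|%:R).
  by rewrite /G /Phi /= sumr_const ln1 /total_reward big_ord0 mulr0 !subr0.
rewrite G0 => EG.
have : - alpha * expectation (@Defs.total_reward R N M E Rex Rtx T) <= expectation (G T).
  rewrite -expectationZ; apply: le_expectation => // xs.
  by rewrite /G mulNr lerDr.
by move=> EP; have := le_trans EP EG; lra.
Qed.

End Mabsta.

(** * The choice of [gamma] *)

(** To be used with [A = (N + |E|) T] and [C = K ln (M ^ N)]. The choice of [g] makes [C] equal to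
    [g ^ 2 (e - 1) A], which balances the two terms of the regret. *)
Lemma tuned_bound (R : realType) (A C S Ex : R) : 0 < A -> 0 < C ->
  let gamma := Num.min 1 (Num.sqrt (C / ((expR 1 - 1) * A))) in
  0 <= Ex -> S <= A ->
  (1 - gamma) * S - Ex <= (1 - gamma) * C / gamma + (expR 1 - 2) * gamma * A ->
  S - Ex <= 263%:R / 100%:R * Num.sqrt (A * C).
Proof.
move=> A0 C0; set g := Num.sqrt _ => gamma Ex0 SA regret.
have e_ge2 : 2 <= expR 1 :> R by have := expR_ge1Dx (1 : R); lra.
have e_le := expR1_le R.
pose c := Num.sqrt (expR 1 - 1 : R).
have c0 : 0 <= c by exact: sqrtr_ge0.
have cc : c ^+ 2 = expR 1 - 1 by rewrite sqr_sqrtr//; lra.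
have q0 : 0 < C / ((expR 1 - 1) * A) by rewrite divr_gt0// mulr_gt0//; lra.
have g0 : 0 < g by rewrite sqrtr_gt0.
have gg : C = g ^+ 2 * (c ^+ 2 * A).
  rewrite sqr_sqrtr ?ltW// cc divfK// gt_eqF// mulr_gt0//; lra.
have -> : Num.sqrt (A * C) = g * c * A.
  rewrite gg (_ : A * _ = (g * c * A) ^+ 2); last by ring.
  by rewrite sqrtr_sqr ger0_norm// !mulr_ge0// ltW.
(* From [expR 1 <= 2.729]: [4 * (expR 1 - 1) <= 6.916 < 6.9169 = 2.63 ^ 2]. *)
have c_le : 2 * c <= 263%:R / 100%:R by nra.
have c_ge : 1 <= c by nra.
(* If [1 <= g], the trivial bound [S <= A <= g * c * A] suffices. *)
have [g1|g1] := leP 1 g.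
  have : 1 <= g * c by nra.
  by move: (g * c) => gc gc1; nra.
have gammaE : gamma = g by rewrite /gamma min_r// ltW.
rewrite gammaE {}gg (_ : (1 - g) * _ / g = (1 - g) * g * (c ^+ 2 * A)) in regret; last first.
  by field; rewrite gt_eqF.
have e2E : expR 1 - 2 = c ^+ 2 - 1 :> R by rewrite cc; ring.
rewrite e2E in regret.
(* Adding this to [regret] leaves [2 c^2 g A - g^2 c^2 A] on the right, and the negative term is
   dropped. *)
have gS : g * S <= g * A by rewrite ler_pM2l.
have g2 : 0 <= g ^+ 2 * (c ^+ 2 * A) by rewrite !mulr_ge0// ?sqr_ge0 ?ltW.
have gcA : 0 <= g * c * A by rewrite !mulr_ge0// ltW.
have : 2 * c * (g * c * A) <= 263%:R / 100%:R * (g * c * A) by rewrite ler_wpM2r.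
lra.
Qed.

Theorem corollary1 (R : realType) (N M T : nat)
    (N_gt0 : (0 < N)%N) (M_gt0 : (0 < M)%N) (T_gt0 : (0 < T)%N)
    (E : {set 'I_N * 'I_N}) (E_acyclic : acyclic E)
    (Rex : nat -> 'I_N -> 'I_M -> R)
    (Rtx : nat -> 'I_N -> 'I_N -> 'I_M -> 'I_M -> R)
    (Rex01 : forall t i j, (t < T)%N -> 0 <= Rex t i j <= 1)
    (Rtx01 : forall t (m n : 'I_N) j k, (t < T)%N -> (m, n) \in E ->
       0 <= Rtx t m n j k <= 1) :
  let n : R := N%:R in
  let m : R := M%:R in
  let e : R := #|E|%:R in
  let F := [set: assignment N M] in
  let gamma := Num.min 1
    (Num.sqrt ((m * (n + e * m) * ln (m ^+ N)) /
               ((expR 1 - 1) * (n + e) * T%:R))) in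
  let alpha := gamma / (m * (n + e * m)) in
  best_fixed_reward E F Rex Rtx T
    - expected_total_reward E F Rex Rtx gamma alpha T
  <= 263%:R / 100%:R
     * Num.sqrt ((n + e) * (n + e * m) * m * n * T%:R * ln m).
Proof.
cbv zeta; set n : R := N%:R; set m : R := M%:R; set e : R := #|E|%:R.
set F := [set: assignment N M]; set gamma := Num.min 1 _.
set alpha := gamma / _.
set D := _ * Num.sqrt _.
pose y0 : assignment N M := [ffun=> Ordinal M_gt0].
(* [y0] shows that the supremum is over a nonempty set; the bound is then proved against each
   [y]. *)
rewrite lerBlDr; apply: ge_sup.
  by exists (\sum_(t < T) frame_reward E Rex Rtx t y0), y0; rewrite ?inE.
move=> _ [y _ ->]; rewrite -lerBlDr /expected_total_reward.
(* For [M = 1], [ln m = 0] makes [gamma] zero, outside the scope of [regret_bound]; all assignments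
   coincide and the regret is 0. *)
have [M1|M_gt1] := leqP M 1%N.
  have tot_y (xs : T.-tuple (assignment N M)) :
      total_reward E Rex Rtx xs = \sum_(t < T) frame_reward E Rex Rtx t y.
    apply: eq_bigr => t _; congr frame_reward; apply/ffunP => i; apply: val_inj.
    have ord_eq0 (j : 'I_M) : val j = 0%N.
      by apply/eqP; rewrite -leqn0 -ltnS (leq_trans (ltn_ord j)).
    by rewrite !ord_eq0.
  rewrite [X in _ - X](_ : _ = \sum_(t < T) frame_reward E Rex Rtx t y).
    by rewrite subrr mulr_ge0.
  rewrite -[RHS](expectation_cst E Rex Rtx gamma alpha y T).
  by apply: eq_bigr => xs _; rewrite tot_y.
have n0 : 0 < n by rewrite ltr0n.
have m0 : 0 < m by rewrite ltr0n.
have e0 : 0 <= e by rewrite ler0n.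
have T0 : 0 < T%:R :> R by rewrite ltr0n.
have L0 : 0 < ln m by rewrite ln_gt0// ltr1n.
have nem0 : 0 < n + e * m by rewrite ltr_pwDl// mulr_ge0// ltW.
have ne0 : 0 < n + e by rewrite ltr_pwDl.
have cardX : #|{: assignment N M}|%:R = m ^+ N by rewrite card_ffun !card_ord natrX.
have lnX : ln (m ^+ N) = n * ln m by rewrite lnXn// mulr_natl.
have KE : (M * (N + #|E| * M))%:R = m * (n + e * m) by rewrite natrM natrD natrM.
pose A := (n + e) * T%:R; pose C := m * (n + e * m) * ln (m ^+ N).
have A0 : 0 < A by rewrite mulr_gt0.
have C0 : 0 < C by rewrite !mulr_gt0// lnX mulr_gt0.
have gammaE : gamma = Num.min 1 (Num.sqrt (C / ((expR 1 - 1) * A))) by rewrite /A mulrA.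
have e1 : 0 < expR 1 - 1 :> R by have := expR_ge1Dx (1 : R); lra.
have g0 : 0 < gamma.
  by rewrite gammaE lt_min ltr01 sqrtr_gt0 divr_gt0// mulr_gt0.
have g1 : gamma <= 1 by rewrite ge_min lexx.
have g01 : 0 < gamma <= 1 by rewrite g0.
have gge01 : 0 <= gamma <= 1 by rewrite ltW.
have bounds t x : (t < T)%N -> 0 <= frame_reward E Rex Rtx t x <= n + e.
  move=> tT; rewrite -natrD; apply: frame_reward_bounds => [i j|i1 i2 j k ?].
    exact: Rex01.
  exact: Rtx01.
have -> : D = 263%:R / 100%:R * Num.sqrt (A * C).
  by rewrite /D /A /C lnX; congr (_ * Num.sqrt _); ring.
apply: tuned_bound => //.
- rewrite expectationE sumr_ge0// => xs _; rewrite mulr_ge0 ?draws_prob_ge0//.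
  by rewrite sumr_ge0// => t _; case/andP: (bounds t (tnth xs t) (ltn_ord t)).
- rewrite /A mulr_natr -[X in _ *+ X](card_ord T) -sumr_const ler_sum// => t _.
  by case/andP: (bounds t y (ltn_ord t)).
rewrite -gammaE; have a0 : 0 < alpha by rewrite divr_gt0// mulr_gt0.
have aK : alpha * (m * (n + e * m)) = gamma by rewrite divfK// gt_eqF// mulr_gt0.
have := @regret_bound R N M E Rex Rtx gamma alpha T y M_gt0 g01.
rewrite KE cardX natrD => /(_ erefl Rex01 Rtx01).
set S := \sum_(t < T) _; set Ex := expectation _ _ _ _ _ _ _.
rewrite -/n -/e => main; rewrite -(ler_pM2l a0).
rewrite [leLHS](_ : _ = (1 - gamma) * alpha * S - alpha * Ex); last by ring.
(* Since [alpha * K = gamma], the right side of [main] is exactly [alpha] times the one required. *)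
apply: le_trans main _; rewrite le_eqVlt; apply/orP; left; apply/eqP.
rewrite /A /C -aK; field.
by rewrite !gt_eqF.
Qed.
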